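(* Let $D$ be a finite digraph without multiple arcs, possibly with loops, such that every vertex adjacent (by an arc in either direction) to a vertex $x$ carrying a loop is either $x$ itself, a source of $D$, or a sink of $D$. Let $T(D)$ be the total digraph of $D$, and let $v$, $A$, $B$, $L$ denote respectively the number of vertices, sinks, sources and loops of $D$. Then $$i(T(D)) = 2v - A - B - L,$$ where $i(\cdot)$ denotes the intersection number of a digraph.
   Context: Digraphs are finite, may have loops, and have no multiple arcs; $V(D)$ and $E(D)$ are the vertex set and arc set. A source is a vertex with no incoming arcs and a sink is a vertex with no outgoing arcs; loops count as both incoming and outgoing arcs, so a vertex with a loop is neither a source nor a sink. Intersection number: given a set $U$ and a family of ordered pairs $(S_x,T_x)$ of subsets of $U$ indexed by the vertices $x$ of a digraph $H$, the digraph $H$ is the intersection digraph of this family if for all vertices $x,y$ (possibly equal) $(x,y)$ is an arc of $H$ iff $S_x\cap T_y\neq\emptyset$. The intersection number $i(H)$ is the minimum size of a set $U$ such that $H$ is the intersection digraph of a family of ordered pairs of subsets of $U$. Line digraph $L(D)$: vertex set $E(D)$, with an arc from $e$ to $f$ iff the arc $e$ ends (in $D$) at the vertex where the arc $f$ starts (so a loop of $D$ gives a loop of $L(D)$). (This digraph is not to be confused with the number $L$ of loops of $D$.) Subdivision digraph $S(D)$: its vertex set is $V(D)\cup E(D)$ (disjoint union) and for each arc $e=(u,w)$ of $D$ (including loops, $u=w$) it has the arcs $(u,e)$ and $(e,w)$, and no others. Middle digraph $M(D)$: vertex set $V(D)\cup E(D)$, with arc set $E(S(D))\cup E(L(D))$.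 Total digraph $T(D)$: vertex set $V(D)\cup E(D)$, with arc set $E(M(D))\cup E(D)=E(S(D))\cup E(L(D))\cup E(D)$. *)

(* Defs.v *)
From HB Require Import structures.
From mathcomp Require Import all_boot all_order all_algebra.

Set Implicit Arguments.
Unset Strict Implicit.
Unset Printing Implicit Defensive.

(* A digraph (finite, loops allowed, no multiple arcs) is a
   finType [V] of vertices together with its arc relation [D : rel V]. *)

Section Digraph.
Variables (V : finType) (D : rel V).

Definition arc_of : Type := {p : V * V | D p.1 p.2}.
HB.instance Definition _ := Finite.on arc_of.

Definition arc_tail (e : arc_of) : V := (val e).1.
Definition arc_head (e : arc_of) : V := (val e).2.

Definition is_source (x : V) : bool := [forall y, ~~ D y x].
Definition is_sink (x : V) : bool := [forall y, ~~ D x y].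

Definition sources : {set V} := [set x | is_source x].
Definition sinks : {set V} := [set x | is_sink x].
Definition loops : {set arc_of} := [set e | arc_tail e == arc_head e].

Definition line_digraph : rel arc_of := fun e f => arc_head e == arc_tail f.

Definition subdivision_digraph : rel (V + arc_of) := fun a b =>
  match a, b with
  | inl u, inr e => u == arc_tail e
  | inr e, inl w => arc_head e == w
  | _, _ => false
  end.

Definition middle_digraph : rel (V + arc_of) := fun a b =>
  subdivision_digraph a b ||
  match a, b with
  | inr e, inr f => line_digraph e f
  | _, _ => false
  end.

Definition total_digraph : rel (V + arc_of) := fun a b =>
  middle_digraph a b ||
  match a, b with
  | inl u, inl w => D u w
  | _, _ => false
  end.

End Digraph.

Arguments arc_of {V} D.
Arguments line_digraph {V} D.
Arguments subdivision_digraph {V} D.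
Arguments middle_digraph {V} D.
Arguments total_digraph {V} D.

Section IntersectionNumber.
Variables (W : finType) (H : rel W).

Definition intersection_digraph_of (U : finType) (S T : {ffun W -> {set U}}) :
    bool :=
  [forall x, forall y, H x y == (S x :&: T y != set0)].

(* Only the size of the ground set matters (see [has_intersection_repP]), so
   it is taken to be ['I_n]. *)
Definition has_intersection_rep (n : nat) : bool :=
  [exists S : {ffun W -> {set 'I_n}}, exists T : {ffun W -> {set 'I_n}},
     intersection_digraph_of S T].

Lemma has_intersection_repP (n : nat) :
  reflect (exists U : finType, #|U| = n /\
             exists S T : W -> {set U},
               forall x y, H x y <-> S x :&: T y <> set0)
          (has_intersection_rep n).
Proof.
apply: (iffP existsP) => [[S /existsP[T /forallP h]]|[U [Un [S [T h]]]]].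
  exists 'I_n; rewrite card_ord; split=> //; exists S, T => x y.
  by move/forallP/(_ y)/eqP: (h x) => ->; split=> /eqP.
subst n; exists [ffun x => enum_rank @: S x].
apply/existsP; exists [ffun x => enum_rank @: T x].
apply/forallP=> x; apply/forallP=> y; rewrite !ffunE -imsetI; last first.
  by move=> a b _ _; apply: enum_rank_inj.
rewrite imset_eq0; apply/eqP; apply/idP/idP => [/h /eqP //|/eqP n0].
exact/h.
Qed.

Lemma has_intersection_rep_ex : exists n, has_intersection_rep n.
Proof.
exists #|{: W * W}|; apply/has_intersection_repP; exists (W * W)%type.
split=> //; exists (fun x => [set p | (p.1 == x) && H p.1 p.2]).
exists (fun y => [set p | p.2 == y]) => x y; split=> [hxy|/eqP/set0Pn[[a b]]].
  by apply/eqP/set0Pn; exists (x, y); rewrite !inE /= !eqxx hxy.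
by rewrite !inE /= => /andP[/andP[/eqP<- ?] /eqP<-].
Qed.

Definition intersection_number : nat := ex_minn has_intersection_rep_ex.

End IntersectionNumber.

(* Main.v *)
Require Import Defs.
From mathcomp Require Import all_boot all_order all_algebra.
From mathcomp Require Import zify.

(* An intersection representation of size [n] is a cover of the arcs by [n]
   sets [S x T] of arcs.  In the total digraph, the arcs leaving arcs of [D]
   are covered by one such set for each vertex that is not a source, and those
   leaving vertices of [D] by one for each vertex that is not a sink; at a
   looped vertex the two sets merge into one, up to arcs towards neighbours
   that are sinks, and these fit in the sets attached to the neighbours.
   Conversely, picking an arc [e] into each non-source [x] and an arc [f] out
   of each loopless non-sink [u], the arcs [(e, x)] and [(u, f)] of the total
   digraph are such that no two lie in a common [S x T]. *)

Set Implicit Arguments.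
Unset Strict Implicit.
Unset Printing Implicit Defensive.

Import GRing.Theory.
Local Open Scope ring_scope.

(** An element of the ground set witnessing both arcs [F i] and [F j] also witnesses the two crossed
    pairs, which are then arcs too. So distinct indices need distinct witnesses. *)
Lemma leq_intersection_number (W I : finType) (H : rel W) (F : I -> W * W) :
  (forall i, H (F i).1 (F i).2) ->
  (forall i j, H (F i).1 (F j).2 -> H (F j).1 (F i).2 -> i = j) ->
  (#|I| <= intersection_number H)%N.
Proof.
move=> FH Finj; rewrite /intersection_number; case: ex_minnP => n.
move=> /has_intersection_repP[U [<- [S [T ST]]]] _.
have /fin_all_exists[g gP] i :
    exists p, p \in S (F i).1 :&: T (F i).2.
  by apply/set0Pn/eqP/ST.
apply: (leq_card g) => i j gij.
have := gP i; have := gP j; rewrite -gij !inE => /andP[Sj Tj] /andP[Si Ti].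
by apply: Finj; apply/ST/eqP/set0Pn; exists (g i); rewrite inE ?Si ?Sj.
Qed.

Lemma intersection_number_leq (W I : finType) (H : rel W) (S T : W -> pred I) :
  (forall a b, H a b <-> exists i, S a i && T b i) ->
  (intersection_number H <= #|I|)%N.
Proof.
move=> ST; rewrite /intersection_number; case: ex_minnP => n _; apply.
apply/has_intersection_repP; exists I; split=> //.
exists (fun a => [set i | S a i]), (fun b => [set i | T b i]) => a b.
rewrite ST; split=> [[i STi]|/eqP/set0Pn[i]].
  by apply/eqP/set0Pn; exists i; rewrite !inE.
by rewrite !inE => STi; exists i.
Qed.

Section TotalDigraph.
Variables (V : finType) (D : rel V).

(** This type serves both bounds: it indexes the pairwise incompatible arcs and is the ground set of
    the representation. *)
Definition cover_index : finType :=
  ({x | ~~ is_source D x} + {x | ~~ is_sink D x && ~~ D x x})%type.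

Lemma is_sourcePn (x : V) :
  reflect (exists e : arc_of D, arc_head e = x) (~~ is_source D x).
Proof.
rewrite negb_forall; apply: (iffP existsP) => [[y /negPn Dyx]|[e <-]].
  by exists (exist _ (y, x) Dyx).
by exists (arc_tail e); rewrite negbK (valP e).
Qed.

Lemma is_sinkPn (x : V) :
  reflect (exists e : arc_of D, arc_tail e = x) (~~ is_sink D x).
Proof.
rewrite negb_forall; apply: (iffP existsP) => [[y /negPn Dxy]|[e <-]].
  by exists (exist _ (x, y) Dxy).
by exists (arc_head e); rewrite negbK (valP e).
Qed.

Lemma arc_not_source (x y : V) : D x y -> ~~ is_source D y.
Proof. by move=> Dxy; apply/is_sourcePn; exists (exist _ (x, y) Dxy). Qed.

Lemma arc_not_sink (x y : V) : D x y -> ~~ is_sink D x.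
Proof. by move=> Dxy; apply/is_sinkPn; exists (exist _ (x, y) Dxy). Qed.

Lemma card_loops : #|loops D| = #|[set x | D x x]|.
Proof.
have inj : {in loops D &, injective (@arc_tail V D)}.
  move=> [[a b] ab] [[c d] cd]; rewrite !inE /arc_tail /arc_head /=.
  by move=> /eqP eab /eqP ecd eac; apply: val_inj; rewrite /= -eab -ecd eac.
rewrite -(card_in_imset inj); congr #|pred_of_set _|; apply/setP => x.
rewrite inE; apply/imsetP/idP => [[e]|Dxx].
  by rewrite inE => /eqP he ->; have := valP e; rewrite -/(arc_head e) -he.
by exists (exist _ (x, x) Dxx); rewrite // inE.
Qed.

(** Stated additively to avoid truncated subtraction. A looped vertex is not a sink, so sinks and
    looped vertices are counted separately. *)
Lemma card_cover_index :
  (#|cover_index| + #|sinks D| + #|sources D| + #|loops D| = 2 * #|V|)%N.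
Proof.
rewrite card_sum !card_sig card_loops.
have -> : #|[pred x | ~~ is_source D x]| = #|~: sources D|.
  by apply: eq_card => x; rewrite !inE.
have -> : #|[pred x | ~~ is_sink D x && ~~ D x x]|
          = #|~: (sinks D :|: [set x | D x x])|.
  by apply: eq_card => x; rewrite !inE negb_or.
have /eqP : #|sinks D :&: [set x | D x x]| = 0%N.
  apply/eqP; rewrite cards_eq0; apply/eqP/setP => x; rewrite !inE.
  by apply/negP => /andP[sx /arc_not_sink]; rewrite sx.
have := cardsUI (sinks D) [set x | D x x].
have := cardsC (sinks D :|: [set x | D x x]); have := cardsC (sources D).
lia.
Qed.

Lemma cover_index_leq :
  (#|cover_index| <= intersection_number (total_digraph D))%N.
Proof.
pose P (i : cover_index) (p : (V + arc_of D) * (V + arc_of D)) :=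
  match i with
  | inl x => exists2 e, arc_head e = val x & p = (inr e, inl (val x))
  | inr u => exists2 f, arc_tail f = val u & p = (inl (val u), inr f)
  end.
have /fin_all_exists[F FP] i : exists p, P i p.
  case: i => [[x sx]|[u su]] /=.
    by have [e ex] := is_sourcePn _ sx; exists (inr e, inl x); exists e.
  have [f fu] := is_sinkPn _ (andP su).1.
  by exists (inl u, inr f); exists f.
apply: (leq_intersection_number (F := F)) => [i|i j]; move: (FP i).
  case: i => [x|u] [e ee ->] /=.
    by rewrite /total_digraph /middle_digraph /= ee eqxx.
  by rewrite /total_digraph /middle_digraph /= ee eqxx.
move: (FP j); case: i => [x|x]; case: j => [y|y] [e ee ->] [f ff ->];
  rewrite /total_digraph /middle_digraph /line_digraph /= ?orbF ?ee ?ff.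
- by move=> /eqP/val_inj->.
(* In the mixed cases the crossed pairs force the two vertices to coincide and to carry a loop,
   which an [inr] index excludes. *)
- move=> /eqP exy; rewrite exy => Dyy.
  by have /andP[_] := valP y; rewrite Dyy.
- move=> Dxy /eqP eyx; move: Dxy; rewrite eyx => Dxx.
  by have /andP[_] := valP x; rewrite Dxx.
- by move=> /eqP/val_inj->.
Qed.

(** With an index [inl x], a looped [x] is its own tail, which replaces the missing [inr x]. If [x]
    is a sink, all its in-neighbours are tails as well; this adds only arcs to [x], since no arc
    starts at [x]. *)
Definition cover_tails (a : V + arc_of D) (i : cover_index) : bool :=
  match i, a with
  | inl x, inl u => D u (val x) && ((u == val x) || is_sink D (val x))
  | inl x, inr e => arc_head e == val x
  | inr x, inl u => u == val x
  | inr _, inr _ => false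
  end.

Definition cover_heads (b : V + arc_of D) (i : cover_index) : bool :=
  match i, b with
  | inl x, inl w => w == val x
  | inr x, inl w => D (val x) w
  | inl x, inr f | inr x, inr f => arc_tail f == val x
  end.

Lemma total_digraph_cover :
  (forall x y : V, D x x -> D x y -> y = x \/ is_sink D y) ->
  forall a b : V + arc_of D,
    total_digraph D a b <-> exists i, cover_tails a i && cover_heads b i.
Proof.
move=> hloop a b; rewrite /total_digraph /middle_digraph /line_digraph.
split; last first.
  case=> -[[x sx]|[x sx]]; case: a b => [u|e] [w|f] //= /andP[].
  - by move=> /andP[Dux _] /eqP->.
  - move=> /andP[_ /orP[/eqP->|kx] /eqP fx]; first by rewrite fx eqxx.
    by move: (valP f) kx; rewrite -/(arc_tail f) fx => /arc_not_sink/negPf->.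
  - by move=> /eqP-> /eqP->; rewrite eqxx.
  - by move=> /eqP-> /eqP->; rewrite eqxx.
  - by move=> /eqP->.
  - by move=> /eqP-> /eqP->; rewrite eqxx.
case: a b => [u|e] [w|f] /=; rewrite ?orbF.
- move=> Duw; have [Duu|nDuu] := boolP (D u u).
    (* The index sits at the head [w]: it works both for the loop, [w = u], and for a sink [w]. *)
    exists (inl (exist _ w (arc_not_source Duw))) => /=.
    by have [->|->] := hloop _ _ Duu Duw; rewrite ?Duu ?Duw ?eqxx ?orbT.
  have iu : ~~ is_sink D u && ~~ D u u by rewrite (arc_not_sink Duw).
  by exists (inr (exist _ u iu)); rewrite /= eqxx.
- move=> /eqP uf; have [Duu|nDuu] := boolP (D u u).
    exists (inl (exist _ u (arc_not_source Duu))) => /=.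
    by rewrite Duu uf eqxx.
  have iu : ~~ is_sink D u && ~~ D u u.
    by rewrite nDuu andbT; apply/is_sinkPn; exists f.
  by exists (inr (exist _ u iu)); rewrite /= uf eqxx.
- move=> /eqP ew; have sw : ~~ is_source D w by apply/is_sourcePn; exists e.
  by exists (inl (exist _ w sw)); rewrite /= ew eqxx.
- move=> /eqP ef.
  have se : ~~ is_source D (arc_head e) by apply/is_sourcePn; exists e.
  by exists (inl (Sub (arc_head e) se)); rewrite /= ef eqxx.
Qed.

End TotalDigraph.

Theorem theorem3 (V : finType) (D : rel V)
  (hloop : forall x y : V, D x x -> D x y \/ D y x ->
             y = x \/ is_source D y \/ is_sink D y) :
  (intersection_number (total_digraph D))%:Z
  = 2 * #|V|%:Z - #|sinks D|%:Z - #|sources D|%:Z - #|loops D|%:Z.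
Proof.
have hsink x y : D x x -> D x y -> y = x \/ is_sink D y.
  (* The head of an arc is not a source, which rules out the middle alternative. *)
  move=> Dxx Dxy; have [->|[sy|ky]] := hloop _ _ Dxx (or_introl Dxy); auto.
  by move: (arc_not_source Dxy); rewrite sy.
have := intersection_number_leq (total_digraph_cover hsink).
have := cover_index_leq D; have := card_cover_index D.
lia.
Qed.
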